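(* Let $\mu=\mu_1+i\mu_2\in\mathbb C\setminus i\mathbb R$, and let $J=J_\mu$ be the left-invariant complex structure on $G=\mathrm{GL}(2,\mathbb R)$ given by $$Je_0=\tfrac{\mu_2}{\mu_1}e_0-\tfrac{|\mu|^2}{2\mu_1}(e_+-e_-),\quad Jh=e_++e_-,\quad Je_\pm=\pm\tfrac1{\mu_1}e_0\mp\tfrac{\mu_2}{2\mu_1}(e_+-e_-)-\tfrac12h .$$ (i) If $\mu\neq1$ then, up to scale, there is a unique left-invariant locally conformally symplectic (lcs) structure $\omega$ on $\mathrm{GL}(2,\mathbb R)$ such that $(\omega,J)$ is locally conformally pseudo-Kähler. It is given by $$\omega=e^0\wedge(e^+-e^-)-2h^*\wedge(e^++e^-)=e^0\wedge e^1-e^2\wedge e^3,$$ where $(e^0,e^1,e^2,e^3)$ denotes the basis dual to $(e_0,e_1,e_2,e_3)$, with $e_1=\frac12(e_+-e_-)$, $e_2=\frac12h$, $e_3=\frac12(e_++e_-)$. All these structures are of Vaisman type with (positive or negative) definite metric. (ii) If $\mu=1$ then $(\omega,J)$ is locally conformally pseudo-Kähler for every left-invariant lcs structure $\omega=e^0\wedge\phi+d\phi$ on $\mathrm{GL}(2,\mathbb R)$. The locally conformally pseudo-Kähler metric $g=-\omega\circ J$ associated with a non-isotropic $1$-form $\phi=a_hh^*+a_+e^++a_-e^-\in\mathfrak{sl}(2,\mathbb R)^*$ is given by $$g=-\tfrac12(a_+-a_-)(e^0)^2-2(a_+-a_-)(h^* )^2+2(a_++a_-)e^0h^*-2a_+(e^+)^2+2a_-(e^-)^2-a_he^0(e^++e^-)-2a_hh^*(e^+-e^-).$$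 It is of Vaisman type if and only if $a_h=0$ and $a_+=-a_-\neq0$, in which case the metric is definite. In particular, the locally conformally pseudo-Kähler metric $g$ is non-Vaisman and positive definite if and only if, first, $a_h\neq0$ or $a_+\neq-a_-$ and, second, $-a_h^2>4a_+a_-$ and $a_->0>a_+$.
   Context: $\mathfrak{gl}(2,\mathbb R)=\mathbb R e_0\oplus\mathfrak{sl}(2,\mathbb R)$, where $e_0\ne0$ spans the center and $(h,e_+,e_-)$ is a basis of $\mathfrak{sl}(2,\mathbb R)$ with $[h,e_\pm]=\pm2e_\pm$, $[e_+,e_-]=h$; $(e^0,h^*,e^+,e^-)$ is the basis dual to $(e_0,h,e_+,e_-)$, and $\mathfrak{sl}(2,\mathbb R)^*$ is identified with the $1$-forms vanishing on $e_0$. Left-invariant tensors on $\mathrm{GL}(2,\mathbb R)$ are identified with tensors on $\mathfrak{gl}(2,\mathbb R)$, and $d\alpha(X,Y)=-\alpha([X,Y])$ for $1$-forms. A $1$-form $\phi=a_hh^*+a_+e^++a_-e^-$ is non-isotropic if it is non-null for the scalar product on $\mathfrak{sl}(2,\mathbb R)^*$ induced by the Killing form, i.e. $a_h^2+4a_+a_-\neq0$. In the formula for $g$, products of $1$-forms are symmetric products, $\alpha\beta=\frac12(\alpha\otimes\beta+\beta\otimes\alpha)$. An lcs structure is a non-degenerate $2$-form $\omega$ with $d\omega=\lambda\wedge\omega$ for some closed $1$-form $\lambda$ (the Lee form). $(\omega,J)$ is locally conformally pseudo-Kähler if $\omega$ is an lcs structure and $J$ is an integrable complex structure skew-symmetric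 with respect to $\omega$; the associated, possibly indefinite, metric is $g=\omega(\cdot,J\cdot)=-\omega(J\cdot,\cdot)$, also written $-\omega\circ J$. The Lee field $\xi$ is defined by $g(\xi,\cdot)=-\frac12\lambda$. The structure is of Vaisman type if $\xi$ is a parallel unit vector field for the Levi-Civita connection of $g$, where the unit length is understood as a normalization that can be achieved by rescaling $\omega$ by a constant.
   Formalization: In (i), uniqueness up to scale is claimed only among lcs structures with Lee form −e^0 (the forms c e^0∧e^1 − e^2∧e^3 are otherwise counterexamples), and the metric is stated to be definite exactly when μ_1>0 (it is indefinite for μ_1<0). *)

(* Defs.v *)
From mathcomp Require Import all_boot all_order all_algebra.
From mathcomp Require Import complex reals.

Set Implicit Arguments.
Unset Strict Implicit.
Unset Printing Implicit Defensive.
Import Order.TTheory GRing.Theory Num.Theory.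
Local Open Scope ring_scope.

Notation gl2 R := 'M[R]_2 (only parsing).
(* The codomain is [R^o] because ['Hom] wants a vectType. *)
Notation form1 R := 'Hom('M[R]_2, R^o) (only parsing).
(* Bare binary functions; bilinearity and alternation are required by [form2]. *)
Notation bform R := ('M[R]_2 -> 'M[R]_2 -> R) (only parsing).

Section Tensors.
Variable R : realType.
Implicit Types (X Y Z xi : gl2 R) (alpha beta lambda : form1 R).
Implicit Types (omega g : bform R) (J : 'End(gl2 R)).

Definition bracket X Y : gl2 R := X *m Y - Y *m X.

Definition sl2 : {vspace gl2 R} :=
  lker (linfun (@mxtrace R 2 : gl2 R -> R^o)).

Definition form2 omega : Prop :=
  [/\ forall X, linear_for *%R (omega X),
      forall Y, linear_for *%R (omega^~ Y)
    & forall X, omega X X = 0].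

Definition scale2 (c : R) omega : bform R := fun X Y => c * omega X Y.

Definition add2 omega omega' : bform R :=
  fun X Y => omega X Y + omega' X Y.

Definition wedge alpha beta : bform R :=
  fun X Y => alpha X * beta Y - alpha Y * beta X.

Definition wedge12 lambda omega X Y Z : R :=
  lambda X * omega Y Z - lambda Y * omega X Z + lambda Z * omega X Y.

Definition sprod alpha beta : bform R :=
  fun X Y => 2^-1 * (alpha X * beta Y + beta X * alpha Y).

(* Exterior derivatives of left-invariant forms (Chevalley-Eilenberg). *)
Definition d1 alpha : bform R := fun X Y => - alpha (bracket X Y).

Definition d2 omega X Y Z : R :=
  - omega (bracket X Y) Z + omega (bracket X Z) Y - omega (bracket Y Z) X.

Definition closed1 alpha : Prop := forall X Y, d1 alpha X Y = 0.

Definition nondegenerate omega : Prop :=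
  forall X, (forall Y, omega X Y = 0) -> X = 0.

Definition lcs_with_Lee_form omega lambda : Prop :=
  [/\ form2 omega, nondegenerate omega, closed1 lambda
    & forall X Y Z, d2 omega X Y Z = wedge12 lambda omega X Y Z].

Definition lcs omega : Prop := exists lambda, lcs_with_Lee_form omega lambda.

Definition integrable_complex J : Prop :=
  (forall X, J (J X) = - X) /\
  (forall X Y, bracket (J X) (J Y) - J (bracket (J X) Y)
                 - J (bracket X (J Y)) - bracket X Y = 0).

Definition skew_wrt omega J : Prop :=
  forall X Y, omega (J X) Y = - omega X (J Y).

Definition lc_pseudo_Kahler omega J : Prop :=
  [/\ lcs omega, integrable_complex J & skew_wrt omega J].

Definition metric omega J : bform R := fun X Y => omega X (J Y).

Definition Lee_field omega J xi : Prop :=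
  exists2 lambda, lcs_with_Lee_form omega lambda
                & forall X, metric omega J xi X = - 2^-1 * lambda X.

(* A left-invariant connection is determined by its values [nabla X Y] on
   left-invariant fields; as [g Y Z] is then constant, metric compatibility
   has no derivative term. *)
Definition Levi_Civita g (nabla : gl2 R -> gl2 R -> gl2 R) : Prop :=
  [/\ forall X, linear (nabla X),
      forall Y, linear (nabla^~ Y),
      forall X Y, nabla X Y - nabla Y X = bracket X Y
    & forall X Y Z, g (nabla X Y) Z + g Y (nabla X Z) = 0].

(* Replacing [omega] by [c omega] keeps the Lee form, multiplies the metric by
   [c] and the Lee field by [c^-1]; [c] may be negative, so that negative
   definite metrics are covered. *)
Definition Vaisman omega J : Prop :=
  exists2 c : R, c != 0 &
  exists xi nabla,
    [/\ Lee_field (scale2 c omega) J xi,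
        Levi_Civita (metric (scale2 c omega) J) nabla,
        forall X, nabla X xi = 0
      & metric (scale2 c omega) J xi xi = 1].

Definition positive_definite g : Prop := forall X, X != 0 -> 0 < g X X.
Definition negative_definite g : Prop := forall X, X != 0 -> g X X < 0.
Definition definite g : Prop := positive_definite g \/ negative_definite g.

End Tensors.

Record gl2_basis (R : realType) := Gl2Basis {
  e0 : gl2 R;
  hh : gl2 R;
  ep : gl2 R;
  em : gl2 R;
  e0_neq0 : e0 != 0;
  e0_center : forall Z : gl2 R,
    (forall X : gl2 R, bracket Z X = 0) <-> (exists c : R, Z = c *: e0);
  sl2_basis : basis_of (sl2 R) [:: hh; ep; em];
  bracket_hp : bracket hh ep = 2 *: ep;
  bracket_hm : bracket hh em = - 2 *: em;
  bracket_pm : bracket ep em = hh }.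

Section Basis.
Variables (R : realType) (B : gl2_basis R).

Definition std_tuple : 4.-tuple (gl2 R) := [tuple e0 B; hh B; ep B; em B].

(* Dual basis (e^0, h^*, e^+, e^-), indexed by 0, 1, 2, 3. *)
Definition dual (i : 'I_4) : form1 R :=
  linfun (coord std_tuple i : gl2 R -> R^o).
Definition e0d := dual 0.
Definition hd := dual 1.
Definition epd := dual 2.
Definition emd := dual 3.

Definition e1 : gl2 R := 2^-1 *: (ep B - em B).
Definition e2 : gl2 R := 2^-1 *: hh B.
Definition e3 : gl2 R := 2^-1 *: (ep B + em B).

Definition alt_tuple : 4.-tuple (gl2 R) := [tuple e0 B; e1; e2; e3].

(* Dual basis (e^0, e^1, e^2, e^3) of (e_0, e_1, e_2, e_3). *)
Definition alt_dual (i : 'I_4) : form1 R :=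
  linfun (coord alt_tuple i : gl2 R -> R^o).

Definition sl2_tuple : 3.-tuple (gl2 R) := [tuple hh B; ep B; em B].

(* Killing form of sl(2,R): trace of [ad X \o ad Y] in the basis (h, e+, e-). *)
Definition Killing (X Y : gl2 R) : R :=
  \sum_(i < 3) coord sl2_tuple i (bracket X (bracket Y (tnth sl2_tuple i))).

(* [X] is the Killing-dual vector of [phi], so [Killing X X] is the induced
   scalar square of [phi]. *)
Definition non_isotropic (phi : form1 R) : Prop :=
  exists X, [/\ X \in sl2 R,
                forall Y, Y \in sl2 R -> Killing X Y = phi Y
              & Killing X X != 0].

Definition sl2_form (ah ap am : R) : form1 R :=
  ah *: hd + ap *: epd + am *: emd.

Definition omega_of (phi : form1 R) : bform R := add2 (wedge e0d phi) (d1 phi).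

Definition is_J_mu (mu : R[i]) (J : 'End(gl2 R)) : Prop :=
  let mu1 := complex.Re mu in
  let mu2 := complex.Im mu in
  let sqnorm := mu1 ^+ 2 + mu2 ^+ 2 in
  [/\ J (e0 B) = (mu2 / mu1) *: e0 B
                 - (sqnorm / (2 * mu1)) *: (ep B - em B),
      J (hh B) = ep B + em B,
      J (ep B) = mu1^-1 *: e0 B
                 - (mu2 / (2 * mu1)) *: (ep B - em B) - 2^-1 *: hh B
    & J (em B) = - mu1^-1 *: e0 B
                 + (mu2 / (2 * mu1)) *: (ep B - em B) - 2^-1 *: hh B].

Definition omega1 : bform R :=
  add2 (wedge e0d (epd - emd)) (scale2 (- 2) (wedge hd (epd + emd))).

Definition omega1_alt : bform R :=
  add2 (wedge (alt_dual 0) (alt_dual 1))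
       (scale2 (- 1) (wedge (alt_dual 2) (alt_dual 3))).

Definition metric_phi (ah ap am : R) : bform R := fun X Y =>
  - 2^-1 * (ap - am) * sprod e0d e0d X Y
  - 2 * (ap - am) * sprod hd hd X Y
  + 2 * (ap + am) * sprod e0d hd X Y
  - 2 * ap * sprod epd epd X Y
  + 2 * am * sprod emd emd X Y
  - ah * sprod e0d (epd + emd) X Y
  - 2 * ah * sprod hd (epd - emd) X Y.

End Basis.

(* Main.v *)
Require Import Defs.
From mathcomp Require Import all_boot all_order all_algebra.
From mathcomp Require Import complex reals boolp ring lra.
Import Order.TTheory GRing.Theory Num.Theory.
Local Open Scope ring_scope.

(** The proof is a computation in the basis [(e_0, h, e_+, e_-)], organized
    around the forms [omega_phi = e^0 /\ phi + d phi], where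
    [phi = ah h^* + ap e^+ + am e^-].

    Since [e_0] is central, evaluating [d omega = - e^0 /\ omega] on
    [(e_0, Y, Z)] gives [omega = omega_phi] with [phi = omega(e_0, .)], so these
    are all the candidates ([lcs_form_of_Lee]).  The Pfaffian of [omega_phi] is
    [- (ah^2 + 4 ap am)], a multiple of the Killing square of [phi]: hence
    [omega_phi] is non-degenerate as soon as [phi] is non-isotropic, and then
    [- e^0] is its only Lee form, because a closed 1-form vanishes on the
    brackets, that is on sl(2), and [omega_phi] does not vanish on sl(2)
    ([lcs_form_nondegenerate], [Lee_form_unique]).

    The failure [omega (J X, Y) + omega (X, J Y)] of skew-symmetry is the real
    part of a complex alternating form on a complex plane, so it is governed by
    one complex number, linear in [phi]: with [k = mu1 - |mu|^2] and
    [s = ap + am] it vanishes exactly when [k ah = mu2 s] and [k s = - mu2 ah]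
    ([skew_lcs_form]).  The determinant [k^2 + mu2^2] of this system is zero
    only for [mu = 1]; otherwise [ah = s = 0], which leaves the multiples of
    [omega_1 = omega_(e^+ - e^-)].  For [mu = 1] every [phi] is allowed.

    For [omega_1] the Lee field is proportional to
    [xi = 2 e_0 - mu2 (e_+ - e_-)], which is orthogonal to [e_+ - e_-], [h] and
    [e_+ + e_-]; these are pairwise orthogonal as well, so the Levi-Civita
    connection can be written down and [xi] is seen to be parallel
    ([Vaisman_omega1]).  The squared norms of this basis have the signs of
    [- c mu1], [- c mu1], [- c], [- c] for the form [c omega_1], whence
    definiteness if and only if [mu1 > 0] ([definite_omega1]).

    Conversely, a parallel field is Killing, so for [mu = 1] the Lee field [xi]
    of a Vaisman structure satisfies
    [g([xi, X], Y) + g(X, [xi, Y]) = 0] besides [g(xi, .) = e^0 / 2]; these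
    polynomial equations force [phi] to be a multiple of [e^+ - e^-]
    ([Vaisman_lcs_form_mu1]).  Finally, at [mu = 1] the metric splits
    orthogonally into two binary quadratic forms with the same discriminant
    [ah^2 + 4 ap am], which gives the criterion for positive definiteness
    ([positive_definite_metric_phi]). *)

Lemma binary_form_gt0 (R : realType) (p q r x y : R) :
    0 < p -> q ^+ 2 < 4 * p * r -> (x != 0) || (y != 0) ->
  0 < p * x ^+ 2 - q * x * y + r * y ^+ 2.
Proof.
move=> p_gt0 disc_lt0 xy.
rewrite -(pmulr_rgt0 _ p_gt0) -(pmulr_rgt0 _ (ltr0Sn _ 3)).
have -> : 4 * (p * (p * x ^+ 2 - q * x * y + r * y ^+ 2)) =
  (2 * p * x - q * y) ^+ 2 + (4 * p * r - q ^+ 2) * y ^+ 2 by ring.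
have [y0|y0] := eqVneq y 0.
  rewrite y0 eqxx orbF in xy *; rewrite mulr0 subr0 expr0n mulr0 addr0.
  by rewrite exprn_even_gt0 //= !mulf_neq0 ?pnatr_eq0 // gt_eqF.
by rewrite ltr_wpDl ?sqr_ge0 // mulr_gt0 ?subr_gt0 // exprn_even_gt0.
Qed.

Section LcsOnGL2.
Set Implicit Arguments.
Unset Strict Implicit.
Variables (R : realType) (B : gl2_basis R).
Implicit Types (X Y Z xi : 'M[R]_2) (f g omega : 'M[R]_2 -> 'M[R]_2 -> R).

(** * Coordinates in the basis (e_0, h, e_+, e_-) *)

Definition vec (a b c d : R) : 'M[R]_2 :=
  a *: e0 B + b *: hh B + c *: ep B + d *: em B.

Lemma bracketDl X Y Z : bracket (X + Y) Z = bracket X Z + bracket Y Z.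
Proof. by rewrite /bracket mulmxDl mulmxDr opprD addrACA. Qed.

Lemma bracketZl a X Y : bracket (a *: X) Y = a *: bracket X Y.
Proof. by rewrite /bracket -scalemxAl -scalemxAr -scalerBr. Qed.

Lemma bracketC X Y : bracket X Y = - bracket Y X.
Proof. by rewrite /bracket opprB. Qed.

Lemma bracketDr X Y Z : bracket X (Y + Z) = bracket X Y + bracket X Z.
Proof. by rewrite bracketC bracketDl opprD -!bracketC. Qed.

Lemma bracketZr a X Y : bracket X (a *: Y) = a *: bracket X Y.
Proof. by rewrite bracketC bracketZl -scalerN -bracketC. Qed.

Lemma bracketXX X : bracket X X = 0.
Proof. exact: subrr. Qed.

Lemma bracket_e0 X : bracket (e0 B) X = 0.
Proof. by move: X; apply/(e0_center B); exists 1; rewrite scale1r. Qed.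

Lemma bracket_vec a b c d a' b' c' d' :
  bracket (vec a b c d) (vec a' b' c' d') =
  vec 0 (c * d' - d * c') (2 * (b * c' - c * b')) (2 * (d * b' - b * d')).
Proof.
rewrite /vec !bracketDl !bracketDr !bracketZl !bracketZr !bracketXX.
rewrite ![bracket _ (e0 B)]bracketC !bracket_e0 (bracketC (ep B) (hh B)).
rewrite (bracketC (em B) (hh B)) (bracketC (em B) (ep B)).
rewrite bracket_hp bracket_hm bracket_pm.
by apply/matrixP => i j; rewrite !mxE; ring.
Qed.

Lemma sl2_free : free [:: hh B; ep B; em B].
Proof. exact: basis_free (sl2_basis B). Qed.

Lemma sl2P X : reflect (exists b c d, X = vec 0 b c d) (X \in sl2 R).
Proof.
rewrite -(span_basis (sl2_basis B)) !span_cons span_nil addv0 /vec.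
apply: (iffP idP) => [|[b [c [d ->]]]].
  case/memv_addP=> _ /vlineP[b ->] [u u_in ->].
  case/memv_addP: u_in => _ /vlineP[c ->] [_ /vlineP[d ->] ->].
  by exists b, c, d; rewrite scale0r add0r addrA.
by rewrite scale0r add0r -addrA !memv_add ?memvZ ?memv_line.
Qed.

Lemma coord_sl2_vec b c d (i : 'I_3) :
  coord (sl2_tuple B) i (vec 0 b c d) = [:: b; c; d]`_i.
Proof.
rewrite -(coord_sum_free (fun j : 'I_3 => [:: b; c; d]`_j) i sl2_free).
by rewrite !big_ord_recl big_ord0 /= /vec scale0r add0r addr0 addrA.
Qed.

(** The adjoint action of sl(2) on itself is faithful, so the central [e_0] is
    not in sl(2) and completes its basis. *)
Lemma std_free : free (std_tuple B).
Proof.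
rewrite /= free_cons sl2_free andbT (span_basis (sl2_basis B)).
apply/negP => /sl2P[b [c [d e0E]]].
have ad_e0 X i : coord (sl2_tuple B) i (bracket (vec 0 b c d) X) = 0.
  by rewrite -e0E bracket_e0 linear0.
have c0 : c = 0.
  by move: (ad_e0 (vec 0 1 0 0) 1); rewrite bracket_vec !coord_sl2_vec /=; lra.
have d0 : d = 0.
  by move: (ad_e0 (vec 0 1 0 0) 2); rewrite bracket_vec !coord_sl2_vec /=; lra.
have b0 : b = 0.
  by move: (ad_e0 (vec 0 0 1 0) 1); rewrite bracket_vec !coord_sl2_vec /=; lra.
by case/eqP: (e0_neq0 B); rewrite e0E b0 c0 d0 /vec !scale0r !addr0.
Qed.

Lemma std_basis : basis_of fullv (std_tuple B).
Proof. by rewrite basisEfree std_free subvf dimvf dim_matrix. Qed.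

Lemma dual_vec a b c d (i : 'I_4) :
  dual B i (vec a b c d) = [:: a; b; c; d]`_i.
Proof.
pose k (j : 'I_4) := [:: a; b; c; d]`_j.
rewrite lfunE /= -[RHS](coord_sum_free k i std_free).
by rewrite !big_ord_recl big_ord0 /= /vec addr0 !addrA.
Qed.

(** The instances of [dual_vec] that rewriting can find through the names
    [e0d], [hd], [epd] and [emd]. *)
Definition dual_vecE :=
  (fun a b c d => dual_vec a b c d 0, fun a b c d => dual_vec a b c d 1,
   fun a b c d => dual_vec a b c d 2, fun a b c d => dual_vec a b c d 3).

Lemma vecE X : X = vec (e0d B X) (hd B X) (epd B X) (emd B X).
Proof.
rewrite {1}(coord_basis std_basis (memvf X)) !big_ord_recl big_ord0 /=.
rewrite addr0 !addrA /vec !lfunE /=.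
by do 3?[congr (_ + _)]; congr (coord _ _ _ *: _); apply: val_inj.
Qed.

(** Used as an eliminator, it turns statements on arbitrary elements into
    polynomial identities between coordinates. *)
Lemma vec_ind (P : 'M[R]_2 -> Prop) :
  (forall a b c d, P (vec a b c d)) -> forall X, P X.
Proof. by move=> Pvec X; rewrite (vecE X). Qed.

Lemma vec_inj a b c d a' b' c' d' :
  vec a b c d = vec a' b' c' d' -> [/\ a = a', b = b', c = c' & d = d'].
Proof.
move=> eqv; split.
- by have := congr1 (e0d B) eqv; rewrite !dual_vecE.
- by have := congr1 (hd B) eqv; rewrite !dual_vecE.
- by have := congr1 (epd B) eqv; rewrite !dual_vecE.
- by have := congr1 (emd B) eqv; rewrite !dual_vecE.
Qed.

Lemma vec0 : vec 0 0 0 0 = 0.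
Proof. by rewrite /vec !scale0r !addr0. Qed.

Lemma vecD a b c d a' b' c' d' :
  vec a b c d + vec a' b' c' d' = vec (a + a') (b + b') (c + c') (d + d').
Proof. by rewrite /vec; apply/matrixP => i j; rewrite !mxE; ring. Qed.

Lemma vecZ k a b c d : k *: vec a b c d = vec (k * a) (k * b) (k * c) (k * d).
Proof. by rewrite /vec !scalerDr !scalerA. Qed.

Lemma vecN a b c d : - vec a b c d = vec (- a) (- b) (- c) (- d).
Proof. by rewrite -scaleN1r vecZ !mulN1r. Qed.

Lemma e0_vec : e0 B = vec 1 0 0 0.
Proof. by rewrite /vec !scale0r !addr0 scale1r. Qed.

Lemma hh_vec : hh B = vec 0 1 0 0.
Proof. by rewrite /vec !scale0r !addr0 scale1r add0r. Qed.

Lemma ep_vec : ep B = vec 0 0 1 0.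
Proof. by rewrite /vec !scale0r !addr0 scale1r !add0r. Qed.

Lemma em_vec : em B = vec 0 0 0 1.
Proof. by rewrite /vec !scale0r scale1r !add0r. Qed.

Lemma lfun_vec (alpha : 'Hom('M[R]_2, R^o)) a b c d :
  alpha (vec a b c d) = a * alpha (e0 B) + b * alpha (hh B)
                        + c * alpha (ep B) + d * alpha (em B) :> R.
Proof. by rewrite /vec !linearD !linearZ. Qed.

Lemma form1_eq (alpha beta : 'Hom('M[R]_2, R^o)) :
    alpha (e0 B) = beta (e0 B) -> alpha (hh B) = beta (hh B) ->
    alpha (ep B) = beta (ep B) -> alpha (em B) = beta (em B) ->
  alpha = beta.
Proof.
move=> eq0 eq1 eq2 eq3; apply/lfunP; elim/vec_ind=> a b c d.
by rewrite !lfun_vec eq0 eq1 eq2 eq3.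
Qed.

Lemma bform_ext f g : f =2 g -> f = g.
Proof. by move=> fg; apply/funext=> X; apply/funext. Qed.

Lemma sl2_form_vec ah ap am a b c d :
  sl2_form B ah ap am (vec a b c d) = ah * b + ap * c + am * d :> R.
Proof. by rewrite !add_lfunE !scale_lfunE /= !dual_vecE. Qed.

Lemma sl2_formE (phi : 'Hom('M[R]_2, R^o)) : phi (e0 B) = 0 ->
  phi = sl2_form B (phi (hh B)) (phi (ep B)) (phi (em B)).
Proof.
have basisE (ah ap am : R) (psi := sl2_form B ah ap am) :
    [/\ psi (e0 B) = 0, psi (hh B) = ah, psi (ep B) = ap & psi (em B) = am].
  by rewrite /psi e0_vec hh_vec ep_vec em_vec !sl2_form_vec; split; ring.
have [f0 f1 f2 f3] := basisE (phi (hh B)) (phi (ep B)) (phi (em B)).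
by move=> phi0; apply: form1_eq; rewrite ?(f0, f1, f2, f3).
Qed.

Lemma alt_free : free (alt_tuple B).
Proof.
suff: basis_of fullv (alt_tuple B) by exact: basis_free.
rewrite basisEdim size_tuple dimvf dim_matrix leqnn andbT.
apply/subvP; elim/vec_ind=> a b c d _.
have -> : vec a b c d = a *: e0 B + ((c - d) *: e1 B
                        + ((2 * b) *: e2 B + (c + d) *: e3 B)).
  by rewrite /e1 /e2 /e3 /vec; apply/matrixP => i j; rewrite !mxE; field.
have line k (v : 'M[R]_2) : k *: v \in <[v]>%VS by rewrite memvZ ?memv_line.
by rewrite /= !span_cons span_nil addv0 !memv_add ?line.
Qed.

Lemma alt_dual_vec a b c d (i : 'I_4) :
  alt_dual B i (vec a b c d) = [:: a; c - d; 2 * b; c + d]`_i.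
Proof.
pose k (j : 'I_4) := [:: a; c - d; 2 * b; c + d]`_j.
rewrite lfunE /= -[RHS](coord_sum_free k i alt_free).
rewrite !big_ord_recl big_ord0 /k /=; congr (coord _ _ _).
by rewrite /e1 /e2 /e3 /vec; apply/matrixP => i' j'; rewrite !mxE; field.
Qed.

Lemma Killing_vec b c d b' c' d' :
  Killing B (vec 0 b c d) (vec 0 b' c' d')
    = 8 * b * b' + 4 * (c * d' + d * c').
Proof.
rewrite /Killing !big_ord_recl big_ord0 !(tnth_nth 0) /= hh_vec ep_vec em_vec.
by rewrite !bracket_vec !coord_sl2_vec /=; ring.
Qed.

(** * Locally conformally symplectic forms with Lee form - e^0 *)

Definition lcs_form ah ap am := omega_of B (sl2_form B ah ap am).

(** Eight times the Killing square of [ah h^* + ap e^+ + am e^-], and minus the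
    Pfaffian of [lcs_form ah ap am]. *)
Definition disc (ah ap am : R) := ah ^+ 2 + 4 * ap * am.

Lemma non_isotropic_disc ah ap am :
  non_isotropic B (sl2_form B ah ap am) -> disc ah ap am != 0.
Proof.
case=> X [/sl2P[b [c [d ->]]] dualX].
have k b' c' d' :
    Killing B (vec 0 b c d) (vec 0 b' c' d') = ah * b' + ap * c' + am * d'.
  by rewrite dualX ?sl2_form_vec //; apply/sl2P; eauto.
have := k 1 0 0; have := k 0 1 0; have := k 0 0 1; rewrite !Killing_vec.
move=> E3 E2 E1; apply: contra => /eqP D0; apply/eqP.
have ahE : ah = 8 * b by lra.
have apE : ap = 4 * d by lra.
have amE : am = 4 * c by lra.
by move: D0; rewrite /disc ahE apE amE; lra.
Qed.

Lemma lcs_form_vec ah ap am a b c d a' b' c' d' :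
  lcs_form ah ap am (vec a b c d) (vec a' b' c' d') =
    a * (ah * b' + ap * c' + am * d') - a' * (ah * b + ap * c + am * d)
    - (ah * (c * d' - d * c') + ap * (2 * (b * c' - c * b'))
       + am * (2 * (d * b' - b * d'))).
Proof.
by rewrite /lcs_form /omega_of /add2 /wedge /d1 bracket_vec !sl2_form_vec
   !dual_vecE.
Qed.

Lemma scale_lcs_form k ah ap am :
  scale2 k (lcs_form ah ap am) = lcs_form (k * ah) (k * ap) (k * am).
Proof.
apply: bform_ext; elim/vec_ind=> a b c d; elim/vec_ind=> a' b' c' d'.
by rewrite /scale2 !lcs_form_vec; ring.
Qed.

Lemma omega1_lcs_form : omega1 B = lcs_form 0 1 (- 1).
Proof.
apply: bform_ext; elim/vec_ind=> a b c d; elim/vec_ind=> a' b' c' d'.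
rewrite lcs_form_vec /omega1 /add2 /scale2 /wedge !add_lfunE !opp_lfunE /=.
by rewrite !dual_vecE /=; ring.
Qed.

Lemma omega1_altE : omega1 B =2 omega1_alt B.
Proof.
rewrite omega1_lcs_form.
elim/vec_ind=> a b c d; elim/vec_ind=> a' b' c' d'.
by rewrite lcs_form_vec /omega1_alt /add2 /scale2 /wedge !alt_dual_vec /=; ring.
Qed.

Lemma lcs_form_form2 ah ap am : form2 (lcs_form ah ap am).
Proof.
split.
- elim/vec_ind=> a b c d k; elim/vec_ind=> a1 b1 c1 d1.
  by elim/vec_ind=> a2 b2 c2 d2; rewrite vecZ vecD !lcs_form_vec; ring.
- elim/vec_ind=> a b c d k; elim/vec_ind=> a1 b1 c1 d1.
  by elim/vec_ind=> a2 b2 c2 d2; rewrite /= vecZ vecD !lcs_form_vec; ring.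
- by elim/vec_ind=> a b c d; rewrite lcs_form_vec; ring.
Qed.

Lemma lcs_form_nondegenerate ah ap am :
  disc ah ap am != 0 -> Defs.nondegenerate (lcs_form ah ap am).
Proof.
move=> D0; elim/vec_ind=> a b c d K.
have := K (vec 1 0 0 0); have := K (vec 0 1 0 0).
have := K (vec 0 0 1 0); have := K (vec 0 0 0 1).
rewrite !lcs_form_vec /= => E3 E2 E1 E0.
have disc_reg x : disc ah ap am * x = 0 -> x = 0.
  by move/eqP; rewrite mulf_eq0 (negPf D0) => /eqP.
(* The multipliers are the entries of the Pfaffian adjoint of the matrix. *)
have [a0 b0] : a = 0 /\ b = 0.
  split; apply: disc_reg; rewrite /disc.
    move: (congr1 ( *%R ah) E1) (congr1 ( *%R am) E2).
    by move: (congr1 ( *%R ap) E3); lra.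
  move: (congr1 ( *%R ah) E0) (congr1 ( *%R am) E2).
  by move: (congr1 ( *%R ap) E3); lra.
have [c0 d0] : c = 0 /\ d = 0.
  split; apply: disc_reg; rewrite /disc.
    move: (congr1 ( *%R ah) E3) (congr1 ( *%R am) E0).
    by move: (congr1 ( *%R am) E1); lra.
  move: (congr1 ( *%R ah) E2) (congr1 ( *%R ap) E0).
  by move: (congr1 ( *%R ap) E1); lra.
by rewrite a0 b0 c0 d0 vec0.
Qed.

Lemma closed_e0 : closed1 (- e0d B).
Proof.
elim/vec_ind=> a b c d; elim/vec_ind=> a' b' c' d'.
by rewrite /d1 opp_lfunE opprK bracket_vec dual_vecE.
Qed.

Lemma lcs_form_lcs ah ap am :
  disc ah ap am != 0 -> lcs_with_Lee_form (lcs_form ah ap am) (- e0d B).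
Proof.
move=> D0; split; [exact: lcs_form_form2 | exact: lcs_form_nondegenerate
                  | exact: closed_e0 |].
elim/vec_ind=> a b c d; elim/vec_ind=> a' b' c' d'.
elim/vec_ind=> a'' b'' c'' d''.
rewrite /d2 /wedge12 !bracket_vec !lcs_form_vec !opp_lfunE /= !dual_vecE /=.
by ring.
Qed.

(** Because [h], [e_+] and [e_-] are proportional to brackets. *)
Lemma closed1_sl2 (lambda : 'Hom('M[R]_2, R^o)) : closed1 lambda ->
  [/\ lambda (hh B) = 0, lambda (ep B) = 0 & lambda (em B) = 0].
Proof.
move=> cl; split.
- have := cl (ep B) (em B); rewrite /d1 bracket_pm => /eqP.
  by rewrite oppr_eq0 => /eqP.
- have := cl (hh B) (ep B); rewrite /d1 bracket_hp linearZ /= => /eqP.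
  by rewrite oppr_eq0 mulf_eq0 pnatr_eq0 => /eqP.
- have := cl (hh B) (em B); rewrite /d1 bracket_hm linearZ /= => /eqP.
  by rewrite oppr_eq0 mulf_eq0 oppr_eq0 pnatr_eq0 => /eqP.
Qed.

(** Both sides of [d omega = lambda /\ omega] evaluated on [(e_0, Y, Z)] with
    [Y], [Z] in sl(2) give [(lambda (e_0) + 1) omega (Y, Z) = 0]. *)
Lemma Lee_form_unique ah ap am lambda : disc ah ap am != 0 ->
  lcs_with_Lee_form (lcs_form ah ap am) lambda -> lambda = - e0d B.
Proof.
move=> D0 [_ _ /closed1_sl2[l1 l2 l3] dom].
have key b c d b' c' d' :
    (lambda (e0 B) + 1) * lcs_form ah ap am (vec 0 b c d) (vec 0 b' c' d') = 0.
  move: (dom (vec 1 0 0 0) (vec 0 b c d) (vec 0 b' c' d')).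
  by rewrite /wedge12 /d2 !bracket_vec !lfun_vec l1 l2 l3 !lcs_form_vec; lra.
have l0 : lambda (e0 B) = - 1.
  apply/eqP; rewrite -subr_eq0 opprK; apply: contraNT D0 => n0.
  have reg x : (lambda (e0 B) + 1) * x = 0 -> x = 0.
    by move/eqP; rewrite mulf_eq0 (negPf n0) => /eqP.
  have := reg _ (key 1 0 0 0 1 0); have := reg _ (key 0 1 0 0 0 1).
  rewrite !lcs_form_vec => E1 E2.
  have -> : ah = 0 by lra.
  have -> : ap = 0 by lra.
  by rewrite /disc; apply/eqP; ring.
apply: form1_eq; rewrite opp_lfunE ?(l0, l1, l2, l3) /=.
all: by rewrite (e0_vec, hh_vec, ep_vec, em_vec) dual_vecE /= ?oppr0.
Qed.

Lemma form2_antisym omega X Y : form2 omega -> omega X Y = - omega Y X :> R.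
Proof.
case=> linr linl alt; have := alt (1 *: X + Y).
by rewrite (linl _ 1) !(linr _ 1) !alt !mul1r; lra.
Qed.

(** As [e_0] is central, [d omega (e_0, Y, Z) = omega (e_0, [Y, Z])], so that
    the equation [d omega = - e^0 /\ omega] expresses [omega (Y, Z)] through
    the 1-form [omega (e_0, .)]. *)
Lemma lcs_form_of_Lee omega : lcs_with_Lee_form omega (- e0d B) ->
  omega = lcs_form (omega (e0 B) (hh B)) (omega (e0 B) (ep B))
                   (omega (e0 B) (em B)).
Proof.
case=> f2 _ _ dom; have [linr linl alt] := f2.
have om0 X : omega X 0 = 0.
  by have := linr X 1 0 0; rewrite scaler0 addr0; lra.
have phi_vec a b c d : omega (e0 B) (vec a b c d) =
    b * omega (e0 B) (hh B) + c * omega (e0 B) (ep B) + d * omega (e0 B) (em B).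
  by rewrite /vec -[d *: _]addr0 -!addrA !linr om0 alt; ring.
apply: bform_ext; elim/vec_ind=> a b c d; elim/vec_ind=> a' b' c' d'.
move: (dom (e0 B) (vec a b c d) (vec a' b' c' d')).
rewrite /d2 /wedge12 !bracket_e0 bracket_vec lcs_form_vec !opp_lfunE /=.
rewrite !dual_vecE ![omega _ (e0 B)]form2_antisym //.
rewrite ![omega 0 _]form2_antisym // !om0 !phi_vec.
by rewrite e0_vec dual_vecE /=; lra.
Qed.

Lemma disc_omega1 c : c != 0 -> disc 0 c (- c) != 0.
Proof.
move=> c0; have -> : disc 0 c (- c) = - (2 * c) ^+ 2 by rewrite /disc; ring.
by rewrite oppr_eq0 sqrf_eq0 mulf_neq0 ?pnatr_eq0.
Qed.

(** A parallel field is a Killing field: by vanishing torsion the bracket with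
    it is the covariant derivative along it, which is metric. *)
Lemma parallel_Killing g nabla xi X Y :
    Levi_Civita g nabla -> (forall Z, nabla Z xi = 0) ->
  g (bracket xi X) Y + g X (bracket xi Y) = 0.
Proof.
case=> _ _ torsion compat parallel.
by have := compat xi X Y; rewrite -!torsion !parallel !subr0.
Qed.

Section ComplexStructure.
Variables (mu : R[i]) (J : 'End('M[R]_2)).
Hypotheses (mu1_neq0 : complex.Re mu != 0) (J_mu : is_J_mu B mu J).
Notation mu1 := (complex.Re mu).
Notation mu2 := (complex.Im mu).
Notation mu_sqr := (mu1 ^+ 2 + mu2 ^+ 2).

(** * Compatibility with the complex structure *)

Lemma J_vec a b c d : J (vec a b c d) =
  vec ((mu2 * a + c - d) / mu1) (- (c + d) / 2)
      (b - (mu_sqr * a + mu2 * (c - d)) / (2 * mu1))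
      (b + (mu_sqr * a + mu2 * (c - d)) / (2 * mu1)).
Proof.
case: J_mu => J0 Jh Jp Jm.
rewrite /vec !linearD !linearZ /= J0 Jh Jp Jm.
by apply/matrixP => i j; rewrite !mxE; field.
Qed.

Lemma J_integrable : integrable_complex J.
Proof.
split; elim/vec_ind=> a b c d.
  by rewrite !J_vec vecN; congr vec; field.
elim/vec_ind=> a' b' c' d'.
by rewrite !(J_vec, bracket_vec, vecN, vecD) -vec0; congr vec; field.
Qed.

Lemma mu_sqr_neq0 : mu_sqr != 0.
Proof. by rewrite paddr_eq0 ?sqr_ge0 // sqrf_eq0 (negPf mu1_neq0). Qed.

(** The two equations are those of the pairs [(e_0, e_+ + e_-)] and [(e_0, h)].
    They suffice: the form [omega (J X, Y) + omega (X, J Y)] takes equal values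
    on [(J X, Y)] and [(X, J Y)], so it is the real part of a complex
    alternating form on the complex plane spanned by [e_0] and [h], hence of a
    multiple of the determinant. *)
Lemma skew_lcs_form ah ap am : skew_wrt (lcs_form ah ap am) J <->
  (mu1 - mu_sqr) * ah - mu2 * (ap + am) = 0 /\
  (mu1 - mu_sqr) * (ap + am) + mu2 * ah = 0.
Proof.
set E := _ - _; set F := _ + _; split=> [sk|[E0 F0]].
  split.
    have /(congr1 ( *%R mu1))/eqP := sk (vec 1 0 0 0) (vec 0 0 1 1).
    rewrite !J_vec !lcs_form_vec eq_sym -subr_eq0 => /eqP sk0.
    by rewrite -[RHS]sk0 /E; field.
  have /(congr1 ( *%R mu1))/eqP := sk (vec 1 0 0 0) (vec 0 1 0 0).
  rewrite !J_vec !lcs_form_vec -subr_eq0 => /eqP sk0.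
  by rewrite -[RHS]sk0 /F; field.
elim/vec_ind=> a b c d; elim/vec_ind=> a' b' c' d'.
(* [X = x0 e_0 + x1 (J e_0) + b h + x2 (J h)]. *)
pose x1 (c d : R) := - mu1 * (c - d) / mu_sqr.
pose x0 a c d := a - mu2 / mu1 * x1 c d.
pose x2 (c d : R) := (c + d) / 2.
rewrite -[RHS]addr0.
have -> : (0 : R) =
    (F * (x0 a c d * b' - x1 c d * x2 c' d'
          - b * x0 a' c' d' + x2 c d * x1 c' d')
     - E * (x0 a c d * x2 c' d' + x1 c d * b'
            - b * x1 c' d' - x2 c d * x0 a' c' d')) / mu1.
  by rewrite E0 F0 !mul0r subrr mul0r.
rewrite !J_vec !lcs_form_vec /E /F /x0 /x1 /x2.
by field; rewrite mu1_neq0; exact: mu_sqr_neq0.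
Qed.

(** The determinant of the system of [skew_lcs_form] is a sum of two squares,
    zero only for [mu2 = 0] and [mu1 = mu1^2]. *)
Lemma skew_lcs_form_mu_neq1 ah ap am : mu != 1 ->
  skew_wrt (lcs_form ah ap am) J <-> ah = 0 /\ am = - ap.
Proof.
move=> mu_neq1; rewrite skew_lcs_form; split; last first.
  by case=> -> ->; split; ring.
set k := mu1 - _; move=> [E0 F0].
have det_neq0 : k ^+ 2 + mu2 ^+ 2 != 0.
  apply: contra mu_neq1; rewrite paddr_eq0 ?sqr_ge0 // !sqrf_eq0.
  move=> /andP[/eqP k0 /eqP mu2_0].
  move: k0; rewrite /k mu2_0 expr0n addr0 => k0.
  have mu1_1 : mu1 = 1.
    apply: (mulfI mu1_neq0); rewrite mulr1 -expr2.
    by apply/esym/eqP; rewrite -subr_eq0 k0.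
  by rewrite eq_complex mu1_1 mu2_0 /= !eqxx.
have reg x : (k ^+ 2 + mu2 ^+ 2) * x = 0 -> x = 0.
  by move/eqP; rewrite mulf_eq0 (negPf det_neq0) => /eqP.
split.
  by apply: reg; move: (congr1 ( *%R k) E0) (congr1 ( *%R mu2) F0); lra.
suff : ap + am = 0 by lra.
by apply: reg; move: (congr1 ( *%R k) F0) (congr1 ( *%R mu2) E0); lra.
Qed.

Lemma lcs_form_pseudo_Kahler ah ap am :
    disc ah ap am != 0 -> skew_wrt (lcs_form ah ap am) J ->
  lc_pseudo_Kahler (lcs_form ah ap am) J.
Proof.
move=> D0 sk; split=> //; last exact: J_integrable.
by exists (- e0d B); exact: lcs_form_lcs.
Qed.

(** * The metrics of the multiples of omega_1 *)

Lemma metric_omega1_sqr c a b u v (X := vec a b u v) :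
  metric (lcs_form 0 c (- c)) J X X =
    - (c / mu1) * ((mu1 * a) ^+ 2 + (mu2 * a + u - v) ^+ 2
                   + mu1 * ((2 * b) ^+ 2 + (u + v) ^+ 2)).
Proof. by rewrite /X /metric J_vec lcs_form_vec; field. Qed.

Lemma definite_omega1 c : c != 0 ->
  definite (metric (lcs_form 0 c (- c)) J) <-> 0 < mu1.
Proof.
move=> c0; set g := metric _ _; split.
  have h_neq0 : vec 0 1 0 0 != 0.
    by rewrite -vec0; apply/eqP => /vec_inj[_ /eqP]; rewrite oner_eq0.
  have t_neq0 : vec 0 0 1 (- 1) != 0.
    by rewrite -vec0; apply/eqP => /vec_inj[_ _ /eqP]; rewrite oner_eq0.
  have gh : g (vec 0 1 0 0) (vec 0 1 0 0) = - 4 * c.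
    by rewrite /g metric_omega1_sqr; field.
  have : mu1 * g (vec 0 0 1 (- 1)) (vec 0 0 1 (- 1)) = - 4 * c.
    by rewrite /g metric_omega1_sqr; field.
  move=> gt; case=> def; move: (def _ h_neq0) (def _ t_neq0); rewrite gh.
    by move=> gh_gt0 gt_gt0; rewrite -(pmulr_lgt0 _ gt_gt0) gt.
  by move=> gh_lt0 gt_lt0; rewrite -(nmulr_llt0 _ gt_lt0) gt.
move=> mu1_gt0.
have pos X : X != 0 -> 0 < - (mu1 / c) * g X X.
  elim/vec_ind: X => a b u v; apply: contraNT.
  rewrite -leNgt /g metric_omega1_sqr.
  have -> x : - (mu1 / c) * (- (c / mu1) * x) = x by field; apply/andP.
  have := sqr_ge0 (mu1 * a); have := sqr_ge0 (mu2 * a + u - v).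
  have := sqr_ge0 (2 * b); have := sqr_ge0 (u + v) => w_ge0 b_ge0 s_ge0 a_ge0.
  move=> sum_le0.
  have [/eqP a0 /eqP s0] : (mu1 * a) ^+ 2 = 0 /\ (mu2 * a + u - v) ^+ 2 = 0.
    by split; nra.
  have [/eqP b0 /eqP w0] : (2 * b) ^+ 2 = 0 /\ (u + v) ^+ 2 = 0.
    by split; nra.
  move: a0 s0 b0 w0; rewrite !sqrf_eq0 !mulf_eq0 (negPf mu1_neq0) pnatr_eq0 /=.
  move=> /eqP-> /eqP s0 /eqP-> /eqP w0.
  by rewrite -vec0; apply/eqP; congr vec; lra.
have [c_gt0|c_lt0|cE] := ltgtP 0 c; last by rewrite -cE eqxx in c0.
  by right=> X /pos; rewrite nmulr_rgt0 // oppr_lt0 divr_gt0.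
by left=> X /pos; rewrite pmulr_rgt0 // oppr_gt0 pmulr_rlt0 // invr_lt0.
Qed.

(** With [T = e_+ - e_-], [P = e_+ + e_-] and [xi = 2 e_0 - mu2 T], every
    element is [X = (e^0 (X) / 2) xi + s X T + h^* (X) h + p X P].  The formula
    is the bilinear extension of [nabla_Y xi = 0], [nabla_xi Y = [xi, Y]] and of
    the values that the Koszul formula gives on the orthogonal vectors [T], [h],
    [P], such as [nabla_h T = - P / mu1], [nabla_T h = - (2 + 1 / mu1) P] and
    [nabla_h P = T]; the contributions of [xi] turn [2 s] into [2 t]. *)
Definition nabla_omega1 X Y : 'M[R]_2 :=
  let t Z : R := (epd B Z - emd B Z) / 2 in
  let p Z : R := (epd B Z + emd B Z) / 2 in
  let s Z : R := mu2 * e0d B Z / 2 + t Z in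
  let coordP :=
    - 2 * t X * hd B Y - (s X * hd B Y + hd B X * s Y) / mu1 in
  let coordT := hd B X * p Y - p X * hd B Y in
  vec 0 (2 * t X * p Y + (s X * p Y + p X * s Y) / mu1)
      (coordP + coordT) (coordP - coordT).

Lemma Levi_Civita_omega1 c :
  Levi_Civita (metric (lcs_form 0 c (- c)) J) nabla_omega1.
Proof.
split.
- elim/vec_ind=> a b u v k; elim/vec_ind=> a1 b1 c1 d1.
  elim/vec_ind=> a2 b2 c2 d2.
  by rewrite /nabla_omega1 !(vecZ, vecD) !dual_vecE /=; congr vec; field.
- elim/vec_ind=> a b u v k; elim/vec_ind=> a1 b1 c1 d1.
  elim/vec_ind=> a2 b2 c2 d2.
  by rewrite /nabla_omega1 !(vecZ, vecD) !dual_vecE /=; congr vec; field.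
- elim/vec_ind=> a b u v; elim/vec_ind=> a1 b1 c1 d1.
  rewrite /nabla_omega1 bracket_vec !dual_vecE /= vecN vecD.
  by congr vec; field.
- elim/vec_ind=> a b u v; elim/vec_ind=> a1 b1 c1 d1.
  elim/vec_ind=> a2 b2 c2 d2.
  by rewrite /nabla_omega1 !dual_vecE /metric !J_vec !lcs_form_vec /=; field.
Qed.

Lemma Vaisman_omega1 c : c != 0 -> Vaisman (lcs_form 0 c (- c)) J.
Proof.
(* The scale at which the Lee field, [- (2 mu1 k)^-1 (e_0 - mu2 e_1)] for the
   form [k omega_1], has unit length; it is then [2 (e_0 - mu2 e_1)]. *)
move=> c0; pose k := - (4 * mu1)^-1.
have k0 : k != 0 by rewrite oppr_eq0 invr_eq0 mulf_neq0 // pnatr_eq0.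
exists (k / c); first by rewrite mulf_neq0 // invr_eq0.
have -> : scale2 (k / c) (lcs_form 0 c (- c)) = lcs_form 0 k (- k).
  by rewrite scale_lcs_form mulr0 mulrN divfK.
exists (vec 2 0 (- mu2) mu2), nabla_omega1; split.
- exists (- e0d B); first exact/lcs_form_lcs/disc_omega1.
  elim/vec_ind=> a b u v.
  by rewrite /metric J_vec lcs_form_vec opp_lfunE /= dual_vecE /k /=; field.
- exact: Levi_Civita_omega1.
- elim/vec_ind=> a b u v.
  by rewrite /nabla_omega1 !dual_vecE -vec0 /=; congr vec; field.
- by rewrite metric_omega1_sqr /k; field.
Qed.

(** * The metrics for mu = 1 *)

Lemma metric_lcs_form_mu1 ah ap am : mu = 1 ->
  metric (lcs_form ah ap am) J = metric_phi B ah ap am.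
Proof.
move=> mu_eq1; apply: bform_ext.
elim/vec_ind=> a b c d; elim/vec_ind=> a' b' c' d'.
rewrite /metric /metric_phi /sprod !add_lfunE !opp_lfunE /= !dual_vecE.
by rewrite J_vec lcs_form_vec mu_eq1 /=; field.
Qed.

Lemma metric_phi_sqr ah ap am a b c d (X := vec a b c d) :
  metric_phi B ah ap am X X =
    (am / 2 * (a + 2 * b) ^+ 2 - ah * (a + 2 * b) * c + (- 2 * ap) * c ^+ 2)
  + (- ap / 2 * (a - 2 * b) ^+ 2 - ah * (a - 2 * b) * d + 2 * am * d ^+ 2).
Proof.
rewrite /X /metric_phi /sprod !add_lfunE !opp_lfunE /= !dual_vecE /=.
by field.
Qed.

Lemma positive_definite_metric_phi ah ap am :
  positive_definite (metric_phi B ah ap am) <->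
  [/\ - ah ^+ 2 > 4 * ap * am, am > 0 & 0 > ap].
Proof.
split=> [pos|[disc_lt0 am_gt0 ap_lt0]].
  have am_gt0 : 0 < am.
    have /pos : vec 0 0 0 1 != 0.
      by rewrite -vec0; apply/eqP => /vec_inj[_ _ _ /eqP]; rewrite oner_eq0.
    by rewrite metric_phi_sqr; lra.
  split=> //.
    (* The second binary form vanishes on this vector, and the first one takes
       its minimum for the given value of [e^+]. *)
    have /pos : vec (ah / 2) (ah / 4) am 0 != 0.
      by rewrite -vec0; apply/eqP => /vec_inj[_ _ /eqP]; rewrite gt_eqF.
    rewrite metric_phi_sqr; set q := (X in 0 < X).
    have -> : q = am / 2 * (- ah ^+ 2 - 4 * ap * am) by rewrite /q; field.
    by rewrite pmulr_rgt0 ?divr_gt0 ?ltr0n // subr_gt0.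
  have /pos : vec 0 0 1 0 != 0.
    by rewrite -vec0; apply/eqP => /vec_inj[_ _ /eqP]; rewrite oner_eq0.
  by rewrite metric_phi_sqr; lra.
elim/vec_ind=> a b c d; rewrite metric_phi_sqr => X0.
have q1_gt0 := @binary_form_gt0 _ (am / 2) ah (- 2 * ap) (a + 2 * b) c
                 ltac:(lra) ltac:(lra).
have q2_gt0 := @binary_form_gt0 _ (- ap / 2) ah (2 * am) (a - 2 * b) d
                 ltac:(lra) ltac:(lra).
have [/q1_gt0 q1|] := boolP ((a + 2 * b != 0) || (c != 0)).
  have [/q2_gt0 q2|] := boolP ((a - 2 * b != 0) || (d != 0)).
    by rewrite addr_gt0.
  by case/norP=> /negPn/eqP t0 /negPn/eqP d0; rewrite t0 d0; lra.
case/norP=> /negPn/eqP s0 /negPn/eqP c0.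
rewrite s0 c0 !(expr0n, mulr0, oppr0, mul0r, add0r); apply: q2_gt0.
apply: contraNT X0 => /norP[/negPn/eqP t0 /negPn/eqP d0].
by rewrite -vec0 c0 d0; apply/eqP; congr vec; lra.
Qed.

(** Absorb the scale into [phi], and let [(k0, k1, k2, k3)] be the coordinates
    of the Lee field [xi].  The Killing equations give [ah k2 = ah k3 = 0] and
    [ap k1 = am k1 = 0], while [g (xi, .) = e^0 / 2] contains
    [ah k0 + 2 ap k2 - 2 am k3 = 0], [ap k0 - 2 ap k1 + ah k3 = - 1 / 2] and
    [am k0 + 2 am k1 - ah k2 = 1 / 2].  If [ah] were nonzero, then
    [k2 = k3 = 0], so [k0 = 0], against the second of these equations.  Hence
    [ah = 0], so [ap] is nonzero and [k1 = 0], and what remains is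
    [ap k0 = - 1 / 2] and [am k0 = 1 / 2]. *)
Lemma Vaisman_lcs_form_mu1 ah ap am : mu = 1 -> disc ah ap am != 0 ->
  Vaisman (lcs_form ah ap am) J -> [/\ ah = 0, ap = - am & ap != 0].
Proof.
move=> mu_eq1 D0 [k k0]; rewrite scale_lcs_form => Vk.
set h := k * ah in Vk *; set p := k * ap in Vk *; set m := k * am in Vk *.
have D1 : disc h p m != 0.
  have -> : disc h p m = k ^+ 2 * disc ah ap am.
    by rewrite /disc /h /p /m; ring.
  by rewrite mulf_neq0 ?sqrf_eq0.
have reg (x y : R) : x * y = 0 -> y != 0 -> x = 0.
  by move=> /eqP; rewrite mulf_eq0 => /orP[/eqP//|/eqP->]; rewrite eqxx.
suff [h0 pm p0] : [/\ h = 0, p + m = 0 & p != 0].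
  have kreg (x : R) : k * x = 0 -> x = 0 by rewrite mulrC => /reg; apply.
  split; first exact: kreg.
    suff : ap + am = 0 by lra.
    by apply: kreg; rewrite mulrDr.
  by apply: contra p0 => /eqP; rewrite /p => ->; rewrite mulr0.
case: Vk => xi [nabla [[lambda /(Lee_form_unique D1)-> Lee] LC par _]].
have killing X Y := parallel_Killing X Y LC par.
clear par LC nabla; move: Lee killing.
elim/vec_ind: xi => k0' k1 k2 k3; rewrite /metric => Lee killing.
have L0 := Lee (vec 1 0 0 0); have L1 := Lee (vec 0 1 0 0).
have L2 := Lee (vec 0 0 1 1).
have K01 := killing (vec 1 0 0 0) (vec 0 1 0 0).
have K02 := killing (vec 1 0 0 0) (vec 0 0 1 0).
have K03 := killing (vec 1 0 0 0) (vec 0 0 0 1).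
have K11 := killing (vec 0 1 0 0) (vec 0 1 0 0).
have K22 := killing (vec 0 0 1 0) (vec 0 0 1 0).
have K33 := killing (vec 0 0 0 1) (vec 0 0 0 1).
move: L0 L1 L2 K01 K02 K03 K11 K22 K33.
rewrite !bracket_vec !J_vec !lcs_form_vec !opp_lfunE /= !dual_vecE mu_eq1 /=.
move=> L0 L1 L2 K01 K02 K03 K11 K22 K33.
have E2 : k0' * h + 2 * p * k2 - 2 * m * k3 = 0 by lra.
have E3 : k0' * p - 2 * k1 * p + k3 * h = - 2^-1 by lra.
have E4 : k0' * m + 2 * k1 * m - k2 * h = 2^-1 by lra.
have k2h : k2 * h = 0 by lra.
have k3h : k3 * h = 0 by lra.
have k1p : k1 * p = 0 by lra.
have k1m : k1 * m = 0 by lra.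
have h0 : h = 0.
  apply/eqP/negPn/negP => h0.
  have k20 := reg _ _ k2h h0; have k30 := reg _ _ k3h h0.
  have k00 : k0' = 0.
    by apply: (reg _ h) => //; move: E2; rewrite k20 k30; lra.
  by move: E3; rewrite k30 k00; lra.
have p0 : p != 0.
  by apply: contra D1 => /eqP->; rewrite /disc h0; apply/eqP; ring.
split=> //.
have k10 := reg _ _ k1p p0.
have k00 : k0' != 0.
  by apply/eqP => k00; move: E3; rewrite k00 k10 h0; lra.
apply: (reg _ k0') => //.
by move: E3 E4; rewrite k10 h0; lra.
Qed.

End ComplexStructure.
End LcsOnGL2.

(** * The classification *)

Theorem theorem4p9 (R : realType) (B : gl2_basis R) (mu : R[i])
    (J : 'End('M[R]_2))
    (mu_notin_iR : complex.Re mu != 0) (J_is_J_mu : is_J_mu B mu J) :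
  (mu != 1 ->
    [/\ omega1 B =2 omega1_alt B,
        forall omega : 'M[R]_2 -> 'M[R]_2 -> R,
          (lcs_with_Lee_form omega (- e0d B) /\ lc_pseudo_Kahler omega J) <->
          (exists2 c : R, c != 0 & omega =2 scale2 c (omega1 B))
      & forall c : R, c != 0 ->
          Vaisman (scale2 c (omega1 B)) J /\
          (definite (metric (scale2 c (omega1 B)) J) <-> 0 < complex.Re mu)])
  /\
  (mu = 1 ->
    (forall phi : 'Hom('M[R]_2, R^o), phi (e0 B) = 0 ->
       lcs (omega_of B phi) -> lc_pseudo_Kahler (omega_of B phi) J)
    /\
    (forall ah ap am : R,
       let phi := sl2_form B ah ap am in
       let omega := omega_of B phi in
       let g := metric omega J in
       non_isotropic B phi ->
       [/\ lc_pseudo_Kahler omega J,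
           g =2 metric_phi B ah ap am,
           Vaisman omega J <-> (ah = 0 /\ ap = - am /\ ap <> 0),
           Vaisman omega J -> definite g
         & (~ Vaisman omega J /\ positive_definite g) <->
           ((ah <> 0 \/ ap <> - am) /\
            (- ah ^+ 2 > 4 * ap * am /\ am > 0 /\ 0 > ap))])).
Proof.
have scaleE c : scale2 c (omega1 B) = lcs_form B 0 c (- c).
  by rewrite omega1_lcs_form scale_lcs_form mulr0 mulr1 mulrN1.
split=> [mu_neq1|mu_eq1].
  split; first exact: omega1_altE.
    move=> omega; split=> [[lee [_ _ sk]]|[c c0 /bform_ext->]].
      have omE := lcs_form_of_Lee lee; rewrite omE in sk.
      have [ah0 amE] :=
        (skew_lcs_form_mu_neq1 mu_notin_iR J_is_J_mu _ _ _ mu_neq1).1 sk.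
      exists (omega (e0 B) (ep B)); last by rewrite scaleE {1}omE ah0 amE.
      apply/eqP => c0; case: lee => _ nondeg _ _; case/eqP: (e0_neq0 B).
      apply: nondeg; elim/(vec_ind (B := B))=> a b c d.
      by rewrite omE ah0 amE c0 e0_vec lcs_form_vec; ring.
    rewrite scaleE; have D0 := disc_omega1 c0.
    split; first exact: lcs_form_lcs.
    apply: (lcs_form_pseudo_Kahler mu_notin_iR J_is_J_mu) => //.
    exact/(skew_lcs_form_mu_neq1 mu_notin_iR J_is_J_mu).
  move=> c c0; rewrite scaleE; split.
    exact: (Vaisman_omega1 mu_notin_iR J_is_J_mu).
  exact: (definite_omega1 mu_notin_iR J_is_J_mu).
have sk ah ap am : skew_wrt (lcs_form B ah ap am) J.
  apply/(skew_lcs_form mu_notin_iR J_is_J_mu).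
  by rewrite mu_eq1 /=; split; ring.
split=> [phi phi0 lcs_phi|ah ap am /= /non_isotropic_disc D0].
  split=> //; first exact: (J_integrable mu_notin_iR J_is_J_mu).
  by rewrite (sl2_formE phi0); exact: sk.
rewrite -/(lcs_form B ah ap am).
have gE := metric_lcs_form_mu1 mu_notin_iR J_is_J_mu ah ap am mu_eq1.
have VaismanE :
    Vaisman (lcs_form B ah ap am) J <-> ah = 0 /\ ap = - am /\ ap <> 0.
  split=> [|[-> [apE /eqP ap0]]].
    by case/(Vaisman_lcs_form_mu1 mu_notin_iR J_is_J_mu mu_eq1 D0)=> -> -> /eqP.
  have -> : am = - ap by rewrite apE opprK.
  exact: (Vaisman_omega1 mu_notin_iR J_is_J_mu).
split=> //.
- exact: (lcs_form_pseudo_Kahler mu_notin_iR J_is_J_mu).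
- by rewrite gE.
- move/VaismanE => [-> [apE /eqP ap0]].
  have -> : am = - ap by rewrite apE opprK.
  by apply/(definite_omega1 mu_notin_iR J_is_J_mu ap0); rewrite mu_eq1 ltr01.
rewrite gE positive_definite_metric_phi; split.
  case=> nV [disc_lt0 am_gt0 ap_lt0]; split=> //.
  have [ah0|/eqP] := eqVneq ah 0; last by left.
  right=> apE; apply: nV; apply/VaismanE; split=> //; split=> //.
  by apply/eqP; rewrite lt_eqF.
case=> neq [disc_lt0 [am_gt0 ap_lt0]]; split=> // /VaismanE[ah0 [apE _]].
by case: neq.
Qed.
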